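(* Let $n\ge 1$ be an integer. For all vectors $\mathbf{z}=(z_1,\dots,z_n)$ with $0\le z_1\le z_2\le\cdots\le z_n\le 1$ and all $\alpha\in[0,1]$, $$m_\alpha(\mathbf{z})\le m_\alpha^{\text{Hoeffding}}(\mathbf{z}),$$ where the inequality is strict if $\alpha\le 0.5$.
   Context: For vectors $\mathbf{z}=(z_1,\dots,z_n)$ with $0\le z_1\le\cdots\le z_n\le 1$ and $\mathbf{u}=(u_1,\dots,u_n)$ with $0\le u_1\le\cdots\le u_n\le 1$, define $$m(\mathbf{z},\mathbf{u})=1-\sum_{i=1}^n u_i(z_{i+1}-z_i),\qquad z_{n+1}:=1.$$ For a real random variable $Y$ with cumulative distribution function $F_Y$, the quantile function is $Q(1-\alpha,Y)=\inf\{y\in\mathbb{R}:F_Y(y)\ge 1-\alpha\}$ (as an extended real number; the infimum of $\mathbb{R}$ is $-\infty$). Let $\mathbf{U}=(U_1,\dots,U_n)$ be the order statistics (sorted increasingly) of $n$ independent samples from the continuous uniform distribution on $[0,1]$. For fixed $\mathbf{z}$ define $$m_\alpha(\mathbf{z})=Q(1-\alpha,\,m(\mathbf{z},\mathbf{U})),$$ where only $\mathbf{U}$ is random. Define $$m_\alpha^{\text{Hoeffding}}(\mathbf{z})=\frac1n\sum_{i=1}^n z_i+\sqrt{\frac{\ln(1/\alpha)}{2n}},$$ with the convention $\ln(1/0)=+\infty$ (so $m_0^{\text{Hoeffding}}(\mathbf{z})=+\infty$). *)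

(* Defs.v *)
From HB Require Import structures.
From mathcomp Require Import all_boot all_order all_algebra.
From mathcomp Require Import all_classical all_reals all_analysis.
From mathcomp Require Import measurable_realfun.

Set Implicit Arguments.
Unset Strict Implicit.
Unset Printing Implicit Defensive.

Import Order.TTheory GRing.Theory Num.Theory.
Import numFieldNormedType.Exports.

Local Open Scope classical_set_scope.
Local Open Scope ring_scope.

(* Indices are shifted: [tnth z i] is z_(i+1). The default value [1] of [nth]
   is reached exactly at the last index and encodes the convention
   z_(n+1) = 1. *)
Definition mfunc (R : realType) (n : nat) (z u : n.-tuple R) : R :=
  1 - \sum_(i < n) tnth u i * (nth 1 z i.+1 - tnth z i).

(* The infimum is taken in [\bar R]: it is [-oo] when every real y satisfies
   the constraint (p <= 0) and [+oo] when none does. *)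
Definition quantile d (Omega : measurableType d) (R : realType)
    (P : probability Omega R) (p : R) (Y : {RV P >-> R}) : \bar R :=
  ereal_inf [set y%:E | y in [set y : R | (p%:E <= cdf Y y)%E]].

Definition mutually_independent d (Omega : measurableType d) (R : realType)
    (P : probability Omega R) (I : finType) (X : I -> {RV P >-> R}) : Prop :=
  forall (J : {set I}) (A : I -> set R), (forall i, measurable (A i)) ->
    P (\bigcap_(i in [set` J]) (X i @^-1` A i)) =
      (\prod_(i in J) P (X i @^-1` A i))%E.

(* Laws are compared on measurable sets only: the values of a measure on the
   other sets are unconstrained. *)
Definition uniform01 d (Omega : measurableType d) (R : realType)
    (P : probability Omega R) (Y : {RV P >-> R}) : Prop :=
  forall A : set R, measurable A ->
    distribution P Y A = uniform_prob (@ltr01 R) A.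

Section order_statistics.
Context d (Omega : measurableType d) (R : realType) (P : probability Omega R).
Context (n : nat).
Implicit Types (X : 'I_n -> {RV P >-> R}) (z : n.-tuple R).

Definition order_statistics X (w : Omega) : n.-tuple R :=
  [tuple of sort <=%R [tuple X i w | i < n]].

Lemma measurable_order_statistics X :
  measurable_fun [set: Omega] (order_statistics X).
Proof.
apply/measurable_fun_tnthP => i.
apply: (measurability (@RGenCInfty.G R)); first exact: RGenCInfty.measurableE.
move=> /= _ [_] [y] -> <-; rewrite setTI.
pose c w : R := \sum_(j < n) \1_(X j @^-1` `]-oo, y[) w.
have mc : measurable_fun [set: Omega] c.
  apply: measurable_sum => j; apply: measurable_indic.
  by rewrite -[X in measurable X]setTI; exact: measurable_funP.
rewrite (_ : _ @^-1` _ = c @^-1` `]-oo, i%:R]).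
  by rewrite -[X in measurable X]setTI; exact: mc.
apply/seteqP; rewrite /preimage/=.
suff H w : (y <= tnth (order_statistics X w) i) = (c w <= i%:R).
  by split=> w /=; rewrite !in_itv/= andbT H.
set s := [tuple X j w | j < n].
have -> : c w = (count (< y) (sort <=%R s))%:R.
  rewrite count_sort /c -sum1_count big_map natr_sum [RHS]big_mkcond.
  rewrite -[LHS]big_enum.
  apply: eq_bigr => j _; rewrite indicE /=.
  have -> : (w \in X j @^-1` `]-oo, y[) = (X j w < y).
    by apply/idP/idP; rewrite inE /= in_itv.
  by case: ifP.
rewrite ler_nat (tnth_nth 0) /=.
have ss : sorted <=%R (sort <=%R s) by exact: sort_le_sorted.
case: leqP => [ci|ic].
  rewrite (nth_count_ge (x := y)) //.
  by rewrite ci size_sort size_tuple card_ord ltn_ord.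
by apply/negbTE; rewrite -ltNge nth_count_lt.
Qed.

Definition mfunc_order_statistics X z (w : Omega) : R :=
  mfunc z (order_statistics X w).

Lemma measurable_mfunc_order_statistics X z :
  measurable_fun [set: Omega] (mfunc_order_statistics X z).
Proof.
apply: measurable_funB => //; apply: measurable_sum => i.
apply: measurable_funM => //.
by have /measurable_fun_tnthP := measurable_order_statistics X; exact.
Qed.

HB.instance Definition _ X z := isMeasurableFun.Build _ _ Omega R
  (mfunc_order_statistics X z) (measurable_mfunc_order_statistics X z).

Definition m_alpha X (alpha : R) z : \bar R :=
  quantile (1 - alpha) (mfunc_order_statistics X z : {RV P >-> R}).

End order_statistics.

(* The case [alpha = 0] has to be separated since [ln 0^-1 = ln 0 = 0]. *)
Definition m_hoeffding (R : realType) (n : nat) (alpha : R) (z : n.-tuple R)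
    : \bar R :=
  if alpha == 0 then +oo%E
  else (n%:R^-1 * \sum_(i < n) tnth z i
        + Num.sqrt (ln alpha^-1 / (2 * n%:R)))%:E.

(* Main.v *)
Require Import Defs.
From HB Require Import structures.
From mathcomp Require Import all_boot all_order all_algebra.
From mathcomp Require Import all_classical all_reals all_analysis.
From mathcomp Require Import ring lra zify.

Set Implicit Arguments.
Unset Strict Implicit.
Unset Printing Implicit Defensive.

Import Order.TTheory GRing.Theory Num.Theory.
Import numFieldNormedType.Exports.

Local Open Scope classical_set_scope.
Local Open Scope ring_scope.

(* With w_i = z_(i+1) - z_i one has m(z, U) = mean z + sum_i w_i (i/n - U_(i)),
   where w_i >= 0 and z_1 + sum_i w_i = 1, so m(z, U) < mean z + t as soon as
   U_(i) > i/n - t for all i. Hence it suffices to bound the probability that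
   the empirical distribution function exceeds the true one by t > 0 somewhere,
   for every t, by something strictly below exp(-2nt^2) (one-sided DKW
   inequality without restriction on t).

   Let N(x) be the number of sample points below x. For every c > 0,
   (1 + c/x)^N(x), run from x = 1 down to 0, is a martingale started at
   (1 + c)^n, so the probability that N(x) >= i for some threshold x = i/n - t
   is at most (1 + c)^n / A when A <= (1 + c/x)^i at all thresholds. The bound
   thus reduces to finding c with
     2t^2 + ln (1 + c) < (q + t) ln (1 + c/q)   for all q > 0,
   which holds when t = c(2c+3) / (2(c+1)(c+3)). *)

(** * Derivative rules and a positivity test *)

Section derivative_test.
Context {R : realType}.
Implicit Types (f df g : R -> R) (a b c q x : R).

(* A copy of [is_derive] that is not a type class: instance search is too slow
   on the rational functions below. *)
Definition deriv_at f x a := is_derive x (1 : R) f a.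

Lemma gt0_of_derive f df b : 0 < b -> f 0 = 0 ->
  (forall x, 0 <= x -> deriv_at f x (df x)) ->
  (forall x, 0 < x -> 0 < df x) -> 0 < f b.
Proof.
move=> b0 f0 fd df0.
have [||x xb] := @MVT R f df 0 b b0.
- by move=> x; rewrite in_itv /= => /andP[/ltW x0 _]; exact: fd.
- apply: derivable_within_continuous => x.
  by rewrite in_itv /= => /andP[x0 _]; have [] := fd x x0.
rewrite f0 !subr0 => ->; rewrite mulr_gt0 // df0 //.
by move: xb; rewrite in_itv => /andP[].
Qed.

Lemma deriv_atD f g x a b : deriv_at f x a -> deriv_at g x b ->
  deriv_at (fun y => f y + g y) x (a + b).
Proof. by move=> df dg; exact: is_deriveD. Qed.

Lemma deriv_atN f x a : deriv_at f x a -> deriv_at (fun y => - f y) x (- a).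
Proof. by move=> df; exact: is_deriveN. Qed.

Lemma deriv_atM f g x a b : deriv_at f x a -> deriv_at g x b ->
  deriv_at (fun y => f y * g y) x (f x * b + g x * a).
Proof. by move=> df dg; exact: is_deriveM. Qed.

Lemma deriv_atV f x a : f x != 0 -> deriv_at f x a ->
  deriv_at (fun y => (f y)^-1) x (- (f x) ^- 2 * a).
Proof. by move=> fx df; exact: is_deriveV. Qed.

Lemma deriv_at_ln f x a : 0 < f x -> deriv_at f x a ->
  deriv_at (fun y => ln (f y)) x ((f x)^-1 * a).
Proof.
move=> fx df.
exact: (@is_derive1_comp R (@ln R) f _ _ _ (is_derive1_ln fx) df).
Qed.

Lemma deriv_at_cst a x : deriv_at (fun=> a) x 0.
Proof. exact: is_derive_cst. Qed.

Lemma deriv_at_id x : deriv_at (fun y => y) x 1.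
Proof. exact: is_derive_id. Qed.

Lemma deriv_at_eq f x a b : deriv_at f x a -> a = b -> deriv_at f x b.
Proof. by move=> ? <-. Qed.

End derivative_test.

(** Differentiates along the syntax, leaving the side conditions of inverse and logarithm as goals
    and taking the derivative of [level] from the context. The raw result is put into the wanted
    form afterwards by [deriv_at_eq] and [field]. *)
Ltac deriv_rule := lazymatch goal with
  | |- deriv_at (fun=> ?a) ?x _ => exact (deriv_at_cst a x)
  | |- deriv_at (fun y => y) ?x _ => exact (deriv_at_id x)
  | |- deriv_at (fun y => @?f y + @?g y) _ _ =>
      refine (@deriv_atD _ f g _ _ _ _ _); deriv_rule
  | |- deriv_at (fun y => - @?f y) _ _ =>
      refine (@deriv_atN _ f _ _ _); deriv_rule
  | |- deriv_at (fun y => @?f y * @?g y) _ _ =>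
      refine (@deriv_atM _ f g _ _ _ _ _); deriv_rule
  | |- deriv_at (fun y => (@?f y)^-1) _ _ =>
      refine (@deriv_atV _ f _ _ _ _); [|deriv_rule]
  | |- deriv_at (fun y => ln (@?f y)) _ _ =>
      refine (@deriv_at_ln _ f _ _ _ _); [|deriv_rule]
  | |- deriv_at (fun y => ?f y) _ _ => eassumption
  | |- deriv_at _ _ _ => eassumption
  end.

(** * The rate inequality linking c and t *)

Section rate.
Context {R : realType}.
Implicit Types (c q : R).

(* The best c for a given t solves a transcendental equation; this rational
   relation agrees with it to second order (t = c/2 - c^2/3 + ...), which is
   enough for [level_rate]. *)
Definition level c : R := c * (2 * c + 3) / (2 * (c + 1) * (c + 3)).

Let W c : R := 5 * c * c + 12 * c + 9.

Let dlevel c : R := W c / (2 * ((c + 1) * (c + 3)) ^+ 2).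

(** The derivative of [phi q] divided by [dlevel]. After this division the logarithms have constant
    coefficients, so one more differentiation gives a rational function. *)
Let psi q c : R := ln (c + q) - ln q
  + c * (c + 1) * (c + 3) * (2 * q * (c + 3) - 3) / ((c + q) * W c)
  - 4 * level c.

Let W_gt0 c : 0 <= c -> 0 < W c.
Proof. by rewrite /W => c0; nra. Qed.

Let deriv_level c : 0 <= c -> deriv_at level c (dlevel c).
Proof.
move=> c0.
have c1 : c + 1 != 0 by apply: lt0r_neq0; lra.
have c3 : c + 3 != 0 by apply: lt0r_neq0; lra.
rewrite /level; apply: deriv_at_eq; first by deriv_rule; rewrite !mulf_neq0.
by rewrite /dlevel /W /=; field; rewrite c1 c3.
Qed.

(** The difference of the two sides of [level_rate]. *)
Let phi q c : R :=
  (q + level c) * (ln (c + q) - ln q) - ln (c + 1) - 2 * (level c * level c).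

Let deriv_phi q c : 0 < q -> 0 <= c ->
  deriv_at (phi q) c (dlevel c * psi q c).
Proof.
move=> q0 c0.
have c1 : c + 1 != 0 by apply: lt0r_neq0; lra.
have c3 : c + 3 != 0 by apply: lt0r_neq0; lra.
have cq : c + q != 0 by apply: lt0r_neq0; lra.
have dl := deriv_level c0.
rewrite /phi; apply: deriv_at_eq; first by deriv_rule; lra.
rewrite /psi /dlevel /level /=; field.
by rewrite c1 c3 cq lt0r_neq0 ?W_gt0.
Qed.

(* The numerator of the derivative of [psi q]: the coefficients of the powers of
   c are quadratics in q, all nonnegative for q > 0. *)
Let psi_num q c : R :=
  c * (27 * (1 - 2 * q)) ^+ 2
+ 6 * c ^+ 2 * (405 - 1782 * q + 2025 * q ^+ 2)
+ 36 * c ^+ 3 * (99 - 465 * q + 624 * q ^+ 2)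
+ 6 * c ^+ 4 * (495 - 2313 * q + 4023 * q ^+ 2)
+ 18 * c ^+ 5 * (83 - 302 * q + 916 * q ^+ 2)
+ 2 * c ^+ 6 * (237 + 257 * q + 3633 * q ^+ 2)
+ 4 * c ^+ 7 * (43 + 393 * q + 496 * q ^+ 2)
+ 2 * c ^+ 8 * (47 + 343 * q + 151 * q ^+ 2)
+ 1 * c ^+ 9 * (25 + 128 * q + 20 * q ^+ 2)
+ 10 * c ^+ 10 * q.

Let psi_num_gt0 q c : 0 < q -> 0 < c -> 0 < psi_num q c.
Proof.
move=> q0 c0; rewrite /psi_num.
have term_gt0 k m y : 0 < k -> 0 < y -> 0 < k * c ^+ m * y.
  by move=> k0 y0; exact: mulr_gt0 (mulr_gt0 k0 (exprn_gt0 m c0)) y0.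
have q2 : 0 <= q ^+ 2 by exact: sqr_ge0.
(* The coefficients of c^2, ..., c^5 have a negative linear term in q; each of these squares,
   suitably scaled, lies below the corresponding quadratic. *)
have h2 : 0 <= (25 * q - 11) ^+ 2 by exact: sqr_ge0.
have h3 : 0 <= (8 * q - 3) ^+ 2 by exact: sqr_ge0.
have h4 : 0 <= (10 * q - 3) ^+ 2 by exact: sqr_ge0.
have h5 : 0 <= (3 * q - 1) ^+ 2 by exact: sqr_ge0.
do 8 (apply: addr_gt0; last by apply: term_gt0; lra).
apply: ltr_wpDl; last by apply: term_gt0; lra.
exact: mulr_ge0 (ltW c0) (sqr_ge0 _).
Qed.

Let deriv_psi q c : 0 < q -> 0 <= c -> deriv_at (psi q) c
  (psi_num q c / ((c + q) * W c * ((c + 1) * (c + 3))) ^+ 2).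
Proof.
move=> q0 c0.
have c1 : c + 1 != 0 by apply: lt0r_neq0; lra.
have c3 : c + 3 != 0 by apply: lt0r_neq0; lra.
have cq : c + q != 0 by apply: lt0r_neq0; lra.
have dl := deriv_level c0.
have : W c != 0 by apply/lt0r_neq0/W_gt0.
rewrite /psi /psi_num /dlevel /W in dl * => Wc; apply: deriv_at_eq.
  by deriv_rule; [lra|rewrite mulf_neq0].
by rewrite /=; field; rewrite c1 c3 cq Wc.
Qed.

(** Both [psi q] and [phi q] vanish at c = 0. The derivative of [psi q] is positive, hence so is
    [psi q], and therefore the derivative of [phi q]. *)
Lemma level_rate q c : 0 < q -> 0 < c ->
  2 * level c ^+ 2 + ln (1 + c) < (q + level c) * ln (1 + c / q).
Proof.
move=> q0 c0.
have psi_gt0 x : 0 < x -> 0 < psi q x.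
  move=> x0; apply: gt0_of_derive x0 _ (fun x => @deriv_psi q x q0) _.
    by rewrite /psi /level !(add0r, mul0r, mulr0, subrr, oppr0).
  move=> y y0; have Wy := W_gt0 (ltW y0).
  apply: divr_gt0; first exact: psi_num_gt0.
  by apply/exprn_gt0/mulr_gt0; apply: mulr_gt0; lra.
have : 0 < phi q c.
  apply: gt0_of_derive c0 _ (fun x => @deriv_phi q x q0) _.
    by rewrite /phi /level !(add0r, mul0r, mulr0, subrr, ln1, oppr0).
  move=> x x0; rewrite mulr_gt0 ?psi_gt0 // divr_gt0 ?(W_gt0 (ltW x0)) //.
  by rewrite mulr_gt0 // exprn_gt0 // mulr_gt0 //; lra.
have -> : 1 + c / q = (c + q) / q by field; exact: lt0r_neq0.
rewrite ln_div ?posrE //; last lra.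
by rewrite /phi expr2 (addrC c 1); lra.
Qed.

Lemma level_surj (t : R) : 0 < t < 1 -> exists2 c, 0 < c & level c = t.
Proof.
move=> /andP[t0 t1].
(* Clearing denominators in [level c = t] gives 2(1-t)c^2 + (3-8t)c - 6t = 0, with discriminant 9 +
   16t^2; c will be its positive root. *)
pose s := Num.sqrt (9 + 16 * t ^+ 2).
have s2 : s ^+ 2 = 9 + 16 * t ^+ 2 by rewrite sqr_sqrtr //; nra.
have s3 : 3 - 8 * t < s.
  have [|h] := ltP (3 - 8 * t) 0.
    by move/lt_le_trans; apply; exact: sqrtr_ge0.
  by rewrite -(ltr_pXn2r (n := 2)) ?nnegrE ?sqrtr_ge0 // s2; nra.
pose c := (8 * t - 3 + s) / (4 * (1 - t)).
have c0 : 0 < c by rewrite divr_gt0 //; lra.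
exists c => //.
have t1' : 1 - t != 0 by apply: lt0r_neq0; lra.
have sE : s = 4 * (1 - t) * c - 8 * t + 3 by rewrite /c; field.
have cE : c * (2 * c + 3) = t * (2 * (c + 1) * (c + 3)).
  have : (4 * (1 - t)) * (c * (2 * c + 3) - t * (2 * (c + 1) * (c + 3))) = 0.
    by move: s2; rewrite sE => s2; nra.
  by move/eqP; rewrite !mulf_eq0 pnatr_eq0 (negbTE t1') /= subr_eq0 => /eqP.
by rewrite /level cE mulfK // !mulf_neq0 // lt0r_neq0 //; lra.
Qed.

End rate.

(** * A discrete maximal inequality for the number of points below a level *)

Section ballot.
Context {R : realFieldType}.
Variables (n m : nat) (x : nat -> R) (c A : R).
Implicit Types (l : nat) (u v : {ffun 'I_n -> 'I_m.+1}) (a y : 'I_m.+1).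

(** Here [x] plays the role of a cumulative weight on the cells 0, ..., m, and [v] assigns a cell to
    each of the n points. *)
Definition mass l : R := x l - (if l is l'.+1 then x l' else 0).

Definition below l v : nat := #|[pred j | (v j <= l)%N]|.

(** Level i is the threshold for rank i + 1: more than i points at or below it mean that the order
    statistic of rank i + 1 is too small. *)
Definition overfull l v : bool :=
  [exists i : 'I_m.+1, (i <= l)%N && (i < below i v)%N].

(** The maximum with l merges the cells 0, ..., l into one. *)
Let same l u v : bool := [forall j, maxn (v j) l == maxn (u j) l].

Let same_below l u v : same l u v -> below l v = below l u.
Proof.
move=> /forallP uv; apply: eq_card => j; rewrite !inE.
by have /eqP := uv j; case: (leqP (v j) l); case: (leqP (u j) l) => //; lia.
Qed.

Let overfullS l v : (l < m)%N -> (below l.+1 v <= l.+1)%N ->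
  overfull l.+1 v = overfull l v.
Proof.
move=> lm vl; apply/existsP/existsP => -[i /andP[il iv]]; exists i.
  rewrite iv andbT; move: il; rewrite leq_eqVlt => /orP[/eqP il|//].
  by move: iv; rewrite il ltnNge vl.
by rewrite iv andbT leqW.
Qed.

Let sum_mass l : (l <= m)%N -> \sum_(y : 'I_m.+1 | (y <= l)%N) mass y = x l.
Proof.
move=> lm; rewrite -(big_ord_widen m.+1 mass (n1 := l.+1)) //.
elim: l {lm} => [|l IH]; first by rewrite big_ord1 /mass subr0.
by rewrite big_ord_recr IH /mass /= addrC subrK.
Qed.

Hypothesis x_ge0 : forall l, 0 <= x l.
Hypothesis x_le : forall l, x l <= x l.+1.
Hypothesis c_ge0 : 0 <= c.
Hypothesis A_ge0 : 0 <= A.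
Hypothesis Ax : forall l, (l < n)%N -> A * x l ^+ l.+1 <= (x l + c) ^+ l.+1.

Let mass_ge0 l : 0 <= mass l.
Proof. by rewrite /mass; case: l => [|l]; rewrite ?subr0 // subr_ge0. Qed.

(** With N points in the merged cells, the product of these factors is the weight of the class times
    the martingale value (1 + c/x)^N at x = [x l], written without a division since [x l] may be
    0. *)
Let shifted_mass l y : R := if (y <= l)%N then x l + c else mass y.

Let prod_below l u (b : R) (F : 'I_n -> R) :
  \prod_j (if (u j <= l)%N then b else F j) =
  b ^+ below l u * \prod_(j | ~~ (u j <= l)%N) F j.
Proof. by rewrite big_if /= prodr_const. Qed.

Let prod_mass_ge0 v : 0 <= \prod_j mass (v j).
Proof. by apply: prodr_ge0. Qed.

Let sum_same l u (F : 'I_n -> 'I_m.+1 -> R) :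
  \sum_(v | same l u v) \prod_j F j (v j) =
  \prod_j \sum_(y : 'I_m.+1 | maxn y l == maxn (u j) l) F j y.
Proof.
rewrite bigA_distr_big_dep; apply: eq_bigl => v.
by apply/forallP/familyP => uv j; have := uv j.
Qed.

(** The merged points contribute (x l)^N with N > l. Hypothesis [Ax] handles l + 1 of these factors,
    and x l <= x l + c the remaining ones. *)
Let sum_overfull_now l u : (l <= m)%N -> (l < below l u)%N ->
  A * \sum_(v | same l u v) \prod_j mass (v j) <=
  \prod_j shifted_mass l (u j).
Proof.
move=> lm ul.
rewrite (sum_same l u (fun=> mass)).
rewrite [X in A * X](_ : _ =
    \prod_j (if (u j <= l)%N then x l else mass (u j))); last first.
  apply: eq_bigr => j _; case: (leqP (u j) l) => [ujl|luj].
    rewrite -(sum_mass lm); apply: eq_bigl => y /=.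
    by case: (leqP y l) => yl; lia.
  rewrite (bigD1 (u j)) /=; last by lia.
  rewrite big1 ?addr0 // => y /andP[/eqP yu /eqP].
  by case; apply/val_inj => /=; lia.
have prodE b := prod_below l u b (fun j => mass (u j)).
rewrite /shifted_mass !prodE mulrA ler_wpM2r ?prodr_ge0 //.
have [k ->] : exists k, below l u = (l.+1 + k)%N.
  by exists (below l u - l.+1)%N; lia.
have ln : (l < n)%N.
  by apply: leq_trans ul _; rewrite -[X in (_ <= X)%N]card_ord max_card.
rewrite !exprD mulrA ler_pM ?Ax ?mulr_ge0 ?exprn_ge0 //.
by rewrite lerXn2r ?nnegrE ?addr_ge0 // lerDl.
Qed.

(** A canonical representative of the class of [v] under [same l]. *)
Let truncate l v : {ffun 'I_n -> 'I_m.+1} := [ffun j => inord (maxn (v j) l)].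

Let truncateE l v j : (l <= m)%N -> truncate l v j = maxn (v j) l :> nat.
Proof. by move=> lm; rewrite ffunE inordK // ltnS geq_max lm -ltnS ltn_ord. Qed.

(* Optional stopping for the martingale (1 + c/x)^N(x), conditionally on the
   positions of the points above level l, which [same l u] fixes. *)
Let sum_overfull l u : (l <= m)%N ->
  A * \sum_(v | same l u v && overfull l v) \prod_j mass (v j) <=
  \prod_j shifted_mass l (u j).
Proof.
elim: l u => [|l IH] u lm.
  case: (leqP (below 0 u) 0) => [u0|/(sum_overfull_now lm)]; last first.
    apply: le_trans; rewrite ler_wpM2l // [leRHS](bigID (overfull 0)) /=.
    by rewrite lerDl sumr_ge0.
  rewrite [X in A * X]big_pred0 ?mulr0 => [|v].
    apply: prodr_ge0 => j _; rewrite /shifted_mass.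
    by case: ifP => _; [exact: addr_ge0|exact: mass_ge0].
  apply/negP => /andP[/same_below vu /existsP[i /andP[]]].
  by rewrite leqn0 => /eqP ->; rewrite vu ltnNge u0.
(* If the threshold is crossed at level l + 1 the process stops there; otherwise a crossing can only
   occur at a level up to l. *)
case: (leqP (below l.+1 u) l.+1) => [ul|/(sum_overfull_now lm)]; last first.
  apply: le_trans; rewrite ler_wpM2l // [leRHS](bigID (overfull l.+1)) /=.
  by rewrite lerDl sumr_ge0.
(* The class of [u] at level l + 1 splits into classes at level l, indexed by their truncated
   representatives; the induction hypothesis applies to each. *)
pose fixed t := truncate l t == t.
have -> : \sum_(v | same l.+1 u v && overfull l.+1 v) \prod_j mass (v j) =
    \sum_(t | same l.+1 u t && fixed t)
      \sum_(v | same l t v && overfull l v) \prod_j mass (v j).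
  rewrite (partition_big (truncate l) (fun t => same l.+1 u t && fixed t)).
    apply: eq_bigr => t /andP[/forallP ut /eqP tt]; apply: eq_bigl => v.
    have tE : (truncate l v == t) = same l t v.
      apply/eqP/forallP => [<- j|tv]; first by rewrite truncateE; lia.
      apply/ffunP => j; apply/val_inj; have /eqP := tv j; rewrite -{2}tt.
      by rewrite /= !truncateE; lia.
    rewrite tE andbC; case: (boolP (same l t v)) => //= /forallP tv.
    have uv : same l.+1 u v.
      by apply/forallP => j; have /eqP := tv j; have /eqP := ut j; lia.
    by rewrite uv overfullS // (same_below uv).
  move=> v /andP[/forallP uv _]; apply/andP; split.
    by apply/forallP => j; have /eqP := uv j; rewrite truncateE; lia.
  by apply/eqP/ffunP => j; apply/val_inj; rewrite /= !truncateE; lia.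
rewrite mulr_sumr; apply: (@le_trans _ _
    (\sum_(t | same l.+1 u t && fixed t) \prod_j shifted_mass l (t j))).
  by apply: ler_sum => t _; apply: IH; lia.
have fE t : same l.+1 u t && fixed t = (t \in family (fun j =>
    [pred y : 'I_m.+1 | (maxn y l.+1 == maxn (u j) l.+1) && (l <= y)%N])).
  apply/andP/familyP => [[/forallP ut /eqP tt] j|ut].
    by rewrite inE ut -tt truncateE; lia.
  split; first by apply/forallP => j; have /andP[] := ut j.
  apply/eqP/ffunP => j; apply/val_inj; have /andP[_] := ut j.
  by rewrite /= truncateE; lia.
rewrite (eq_bigl _ _ fE).
rewrite -(bigA_distr_big_dep (fun j => [pred y : 'I_m.+1 |
   (maxn y l.+1 == maxn (u j) l.+1) && (l <= y)%N]) (fun=> shifted_mass l)).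
rewrite le_eqVlt; apply/orP; left; apply/eqP/eq_bigr => j _.
rewrite /shifted_mass.
(* The martingale property, point by point: a merged point is either at or below l or exactly at l +
   1, and (x l + c) + (x (l+1) - x l) = x (l+1) + c. A point above l + 1 keeps its cell. *)
case: (leqP (u j) l.+1) => [ujl|luj].
  rewrite (bigD1 (inord l)) /=; last by rewrite ?inE inordK; lia.
  rewrite (bigD1 (inord l.+1)) /=; last first.
    by rewrite ?inE -val_eqE /= !inordK; lia.
  rewrite big1 => [|y /andP[/andP[]]]; last first.
    by rewrite ?inE -!val_eqE /= !inordK; lia.
  rewrite !inordK //; last lia.
  by rewrite leqnn ltnn addr0 /mass; ring.
rewrite (bigD1 (u j)) /=; last by rewrite ?inE; lia.
rewrite big1 ?addr0 => [|y /andP[]]; last by rewrite ?inE -val_eqE /=; lia.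
by case: leqP => //; lia.
Qed.

(** At the top level m all cells are merged, so a single class contains every [v]. *)
Lemma sum_overfull_le :
  A * \sum_(v | overfull m v) \prod_j mass (v j) <= (x m + c) ^+ n.
Proof.
have := @sum_overfull m [ffun=> ord0] (leqnn m).
rewrite [X in _ <= X](_ : _ = (x m + c) ^+ n); last first.
  rewrite -[X in _ ^+ X](card_ord n) -prodr_const.
  by apply: eq_bigr => j _; rewrite /shifted_mass ffunE leq0n.
congr (_ * _ <= _); apply: eq_bigl => v; rewrite andb_idl // => _.
apply/forallP => j; rewrite ffunE max0n; apply/eqP/maxn_idPr.
by rewrite -ltnS ltn_ord.
Qed.

End ballot.

(** * Deterministic comparison of m(z, u) with the mean of z *)

Section spacings.
Context {R : realType} (n : nat).
Implicit Types (z u : n.-tuple R) (t : R).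

Definition gap z (i : 'I_n) : R := nth 1 z i.+1 - tnth z i.

Lemma sum_gap z : \sum_(i < n) gap z i = 1 - nth 1 z 0.
Proof.
(* The constant 1 is read as the out-of-range entry z_(n+1), so that the sum telescopes. *)
rewrite -[X in X - _](nth_default 1 (n := n) (s := z)) ?size_tuple //.
rewrite -telescope_sumr // big_mkord.
by apply: eq_bigr => i _; rewrite /gap (tnth_nth 1).
Qed.

Lemma sum_rank_gap z :
  \sum_(i < n) i.+1%:R * gap z i = n%:R - \sum_(i < n) tnth z i.
Proof.
have abel (f : nat -> R) k :
    \sum_(i < k) i.+1%:R * (f i.+1 - f i) = k%:R * f k - \sum_(i < k) f i.
  elim: k => [|k IH]; first by rewrite !big_ord0 mul0r subr0.
  by rewrite !big_ord_recr IH /= -[k.+1%:R]natr1; ring.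
rewrite -[X in X - _]mulr1.
rewrite -[X in _ * X - _](nth_default 1 (n := n) (s := z)) ?size_tuple //.
have -> : \sum_(i < n) tnth z i = \sum_(i < n) nth 1 z i.
  by apply: eq_bigr => i _; rewrite (tnth_nth 1).
by rewrite -abel; apply: eq_bigr => i _; rewrite /gap (tnth_nth 1).
Qed.

Lemma mfunc_lt z u t : (0 < n)%N -> 0 < t ->
  sorted <=%R z -> (forall i, 0 <= tnth z i <= 1) ->
  (forall i : 'I_n, i.+1%:R / n%:R - t < tnth u i) ->
  mfunc z u < n%:R^-1 * \sum_(i < n) tnth z i + t.
Proof.
move=> n0 t0 zs z01 ut.
rewrite -[mfunc z u]/(1 - \sum_(i < n) tnth u i * gap z i).
have gap_ge0 i : 0 <= gap z i.
  rewrite subr_ge0 (tnth_nth 1); have [iz|zi] := ltnP i.+1 (size z).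
    by apply: (le_sorted_leq_nth 1 zs); rewrite ?inE // ltnW.
  by rewrite (nth_default _ zi) -tnth_nth; have /andP[] := z01 i.
have n0' : n%:R != 0 :> R by rewrite pnatr_eq0 -lt0n.
have z0 : 0 <= nth 1 z 0.
  by have := z01 (Ordinal n0); rewrite (tnth_nth 1) => /andP[].
pose D i := (tnth u i - (i.+1%:R / n%:R - t)) * gap z i.
have D_ge0 i : 0 <= D i by rewrite mulr_ge0 // subr_ge0 ltW.
have DE : \sum_(i < n) D i = \sum_(i < n) tnth u i * gap z i
    - n%:R^-1 * (n%:R - \sum_(i < n) tnth z i) + t * (1 - nth 1 z 0).
  rewrite -sum_rank_gap -sum_gap !mulr_sumr -sumrB -big_split /=.
  by apply: eq_bigr => i _; rewrite /D; ring.
(* This is exactly the difference of the two sides. Were it 0, all gaps and z_1 would vanish,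
   although together they sum to 1. *)
suff : 0 < \sum_(i < n) D i + t * nth 1 z 0.
  by rewrite DE mulrBr mulVf // => ?; lra.
have sD_ge0 : 0 <= \sum_(i < n) D i by exact: sumr_ge0.
have tz0 : 0 <= t * nth 1 z 0 by rewrite mulr_ge0 // ltW.
rewrite lt0r addr_ge0 // andbT paddr_eq0 //.
apply/negP => /andP[/eqP D0]; rewrite mulf_eq0 gt_eqF //= => /eqP z00.
have gap0 i : gap z i = 0.
  have /eqP := psumr_eq0P (fun i _ => D_ge0 i) D0 (i := i) isT.
  by rewrite mulf_eq0 subr_eq0 gt_eqF //= => /eqP.
have := sum_gap z; rewrite big1 // z00 subr0 => /eqP.
by rewrite eq_sym oner_eq0.
Qed.

End spacings.

(** * Thresholds and the cells they delimit *)

Section cuts.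
Context {R : realFieldType} (n : nat) (t : R).
Hypothesis t_gt0 : 0 < t.

(** The threshold for rank l + 1, clipped at 0 to be a uniform probability. The value 1 from index n
    on gives the last cell the remaining mass. *)
Definition cut l : R := if (l < n)%N then Num.max 0 (l.+1%:R / n%:R - t) else 1.

Lemma cut_ge0 l : 0 <= cut l.
Proof. by rewrite /cut; case: ifP => _; rewrite ?le_max ?lexx. Qed.

Lemma rank_le1 l : (l < n)%N -> l.+1%:R / n%:R <= 1 :> R.
Proof.
move=> ln; rewrite ler_pdivrMr ?mul1r ?ler_nat // ltr0n.
exact: leq_ltn_trans ln.
Qed.

Lemma cut_le1 l : cut l <= 1.
Proof.
rewrite /cut; case: ifP => // /rank_le1 ln.
by rewrite ge_max ler01 (le_trans _ ln) // gerBl ltW.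
Qed.

Lemma cut_leS l : cut l <= cut l.+1.
Proof.
rewrite {2}/cut; case: ifP => l1; last exact: cut_le1.
rewrite /cut (ltnW l1) ge_max !le_max lexx /= lerD2r.
by rewrite ler_wpM2r ?invr_ge0 ?ler_nat ?orbT.
Qed.

Lemma cut_le l k : (l <= k)%N -> cut l <= cut k.
Proof. by move=> lk; apply: (homo_leq lexx le_trans cut_leS). Qed.

(* The cell [n] collects the points above all the cuts [cut l], l < n. *)
Definition cell (r : R) : nat := find (fun l => r <= cut l) (iota 0 n).

Lemma cell_le r : (cell r <= n)%N.
Proof. by rewrite -[X in (_ <= X)%N](size_iota 0 n) find_size. Qed.

Lemma cell_leE r l : (l < n)%N -> (cell r <= l)%N = (r <= cut l).
Proof.
move=> ln; apply/idP/idP => [cl|rl].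
  have cn : (cell r < n)%N by exact: leq_ltn_trans ln.
  apply: le_trans (cut_le cl).
  have := @nth_find _ 0%N (fun l => r <= cut l) (iota 0 n).
  by rewrite has_find size_iota nth_iota // => /(_ cn).
rewrite leqNgt; apply/negP => lc.
by have := before_find 0%N lc; rewrite nth_iota // add0n rl.
Qed.

End cuts.

(** * Union bound and left limits of distribution functions *)

Section probability_facts.
Context d (T : measurableType d) (R : realType) (P : probability T R).

Lemma finite_Boole (I : finType) (Q : pred I) (E : I -> set T) :
  (forall i, measurable (E i)) ->
  (P (\bigcup_(i in [set i | Q i]) E i) <= \sum_(i | Q i) P (E i))%E.
Proof.
move=> mE; rewrite bigcup_mkcond.
have -> : \bigcup_i (if i \in [set i | Q i] then E i else set0)
    = \big[setU/set0]_(i | Q i) E i.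
  rewrite -bigcup_mkcond; apply/seteqP; split => [x [i /= Qi Ex]|x].
    by rewrite (bigD1 i) //=; left.
  elim/big_ind: _ => [//|A B HA HB [/HA//|/HB//]|i Qi Ex].
  by exists i.
suff [] : measurable (\big[setU/set0]_(i | Q i) E i) /\
  (P (\big[setU/set0]_(i | Q i) E i) <= \sum_(i | Q i) P (E i))%E by [].
apply: (big_ind2 (fun A (b : \bar R) => measurable A /\ (P A <= b)%E)).
- by split; rewrite ?measure0.
- move=> A a B b [mA Aa] [mB Bb]; split; first exact: measurableU.
  by apply: le_trans (measureU2 _ mA mB) _; exact: leeD.
- by move=> i _; split.
Qed.

(** The event Y < y0 is the increasing union of the events Y <= y0 - 1/(k+1), so one of these
    already has probability above p. This makes the quantile bound strict. *)
Lemma cdf_left (Y : {RV P >-> R}) (p y0 : R) :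
  (p%:E < P [set w | (Y w < y0)%R])%E ->
  exists2 y, y < y0 & (p%:E <= cdf Y y)%E.
Proof.
move=> pY; apply: contrapT => H.
have cdf_lt y : y < y0 -> (cdf Y y <= p%:E)%E.
  move=> yy0; rewrite leNgt; apply/negP => py.
  by apply: H; exists y => //; exact: ltW.
pose F k : set T := Y @^-1` `]-oo, y0 - k.+1%:R^-1].
have mF k : measurable (F k).
  by rewrite -[F k]setTI; exact: measurable_funP.
have FE : [set w | (Y w < y0)%R] = \bigcup_k F k.
  apply/seteqP; split => [w /= Yw|w [k _]]; last first.
    rewrite /F /= in_itv /= => /le_lt_trans; apply.
    by rewrite ltrBlDr ltrDl invr_gt0.
  have [k] := ltr_add_invr Yw.
  by move=> ky; exists k => //; rewrite /F /= in_itv /= lerBrDr ltW.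
have ndF : {homo F : a b / (a <= b)%N >-> (a <= b)%O}.
  move=> a b ab; apply/subsetPset => w; rewrite /F /= !in_itv /=.
  move=> /le_trans; apply.
  by rewrite lerD2l lerN2 lef_pV2 ?posrE ?ltr0n // ler_nat.
have mUF : measurable (\bigcup_k F k) by exact: bigcup_measurable.
have := nondecreasing_cvg_mu (mu := P) mF mUF ndF.
move=> /[dup] /cvgP cF /cvg_lim lF.
move: pY; rewrite FE -lF // ltNge => /negP; apply.
apply: lime_le => //; apply: nearW => k /=.
by apply: cdf_lt; rewrite ltrBlDr ltrDl invr_gt0.
Qed.

End probability_facts.

(** * Uniform probabilities of the cells *)

Section uniform_cells.
Context (R : realType) (n : nat) (t : R).
Hypothesis t_gt0 : 0 < t.

Lemma uniform_prob_le (a : R) : 0 <= a <= 1 ->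
  uniform_prob (@ltr01 R) `]-oo, a] = a%:E.
Proof.
move=> /andP[a0 a1]; rewrite /uniform_prob integral_uniform_pdf.
have -> : `]-oo, a]%classic `&` `[0, 1]%classic = `[0, a]%classic :> set R.
  apply/seteqP; split => x /=; rewrite !in_itv /=.
    by move=> [-> /andP[->]].
  by move=> /andP[-> xa]; split => //; exact: le_trans a1.
rewrite (eq_integral (cst 1%E)) => [|x].
  rewrite integral_cst //= mul1e lebesgue_measure_itv /= lte_fin.
  by case: ltgtP a0 => // [_ _|<- _]; rewrite ?oppr0 ?adde0 // sube0.
rewrite inE /= in_itv /= => /andP[x0 xa].
by rewrite /uniform_pdf x0 (le_trans xa a1) subr0 invr1.
Qed.

Lemma measurable_cell_le l : measurable [set r : R | (cell n t r <= l)%N].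
Proof.
have [nl|ln] := leqP n l.
  rewrite (_ : [set _ | _] = setT) //; apply/seteqP; split => // r _ /=.
  exact: leq_trans (cell_le _ _ _) nl.
rewrite (_ : [set _ | _] = `]-oo, cut n t l]%classic) //.
by apply/seteqP; split => r /=; rewrite in_itv /= cell_leE.
Qed.

Lemma uniform_cell_le l :
  uniform_prob (@ltr01 R) [set r : R | (cell n t r <= l)%N] = (cut n t l)%:E.
Proof.
have [nl|ln] := leqP n l.
  rewrite (_ : [set _ | _] = setT); last first.
    apply/seteqP; split => // r _ /=.
    exact: leq_trans (cell_le _ _ _) nl.
  by rewrite probability_setT /cut ltnNge nl.
rewrite (_ : [set _ | _] = `]-oo, cut n t l]%classic).
  by rewrite uniform_prob_le // cut_ge0 cut_le1.
by apply/seteqP; split => r /=; rewrite in_itv /= cell_leE.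
Qed.

Lemma cellS_diff l : [set r : R | cell n t r = l.+1] =
  [set r | (cell n t r <= l.+1)%N] `\` [set r | (cell n t r <= l)%N].
Proof. by apply/seteqP; split => r /=; lia. Qed.

Lemma cell0 : [set r : R | cell n t r = 0%N] = [set r | (cell n t r <= 0)%N].
Proof. by apply/seteqP; split => r /=; lia. Qed.

Lemma measurable_cell l : measurable [set r : R | cell n t r = l].
Proof.
case: l => [|l]; first by rewrite cell0; exact: measurable_cell_le.
by rewrite cellS_diff; apply: measurableD; exact: measurable_cell_le.
Qed.

Lemma uniform_cell l :
  uniform_prob (@ltr01 R) [set r : R | cell n t r = l] = (mass (cut n t) l)%:E.
Proof.
case: l => [|l]; first by rewrite cell0 uniform_cell_le /mass subr0.
rewrite /mass EFinB -!uniform_cell_le cellS_diff.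
rewrite measureD; [|exact: measurable_cell_le..|].
  by rewrite setIidr // => r /= /leqW.
by rewrite [X in (X < _)%E]uniform_cell_le ltry.
Qed.

End uniform_cells.

(** * Choice of the martingale parameters c and A *)

Lemma exists_threshold (R : realType) (n : nat) (t alpha : R) :
  0 < t -> 0 < alpha -> ln alpha^-1 <= n%:R * (2 * t ^+ 2) ->
  exists c A : R, [/\ 0 <= c, 0 < A, (1 + c) ^+ n < alpha * A &
    forall l, (l < n)%N -> A * cut n t l ^+ l.+1 <= (cut n t l + c) ^+ l.+1].
Proof.
move=> t0 a0 at2.
(* For t >= 1 every cut of index below n is 0, and any positive c will do. *)
have [c c0 ct] : exists2 c, 0 < c & t < 1 -> level c = t.
  have [t1|t1] := ltP t 1; last by exists 1.
  by have [|c c0 cE] := @level_surj R t; [rewrite t0|exists c].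
pose x := cut n t.
pose ratio (l : 'I_n) := ((x l + c) / x l) ^+ l.+1.
(* The largest A allowed by the positive cuts, capped by twice the bound it has to exceed in case
   there are none. *)
pose A := \big[Order.min/2 * (1 + c) ^+ n / alpha]_(l < n | 0 < x l) ratio l.
have n1c : 0 < (1 + c) ^+ n by rewrite exprn_gt0 // addr_gt0.
have AgtE : (1 + c) ^+ n / alpha < A.
  apply: lt_bigmin => [|l xl].
    by rewrite ltr_pM2r ?invr_gt0 // ltr_pMl // ltr1n.
  have l0 : (0 < n)%N by apply: leq_ltn_trans (ltn_ord l).
  have n0 : n%:R != 0 :> R by rewrite pnatr_eq0 -lt0n.
  have xE : x l = l.+1%:R / n%:R - t.
    move: xl; rewrite /x /cut ltn_ord lt_max ltxx /= => xl.
    by apply/max_idPr/ltW.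
  have t1 : t < 1.
    by have := @rank_le1 R n l (ltn_ord l); move: xl; rewrite xE; lra.
  (* With q = x l this is n times the logarithmic form of the goal, because l + 1 = n (x l + t). *)
  have := level_rate xl c0; rewrite (ct t1) => rate.
  rewrite -ltr_ln ?posrE ?divr_gt0 ?exprn_gt0 ?divr_gt0 ?addr_gt0 //.
  rewrite ln_div ?posrE // !lnXn ?divr_gt0 ?addr_gt0 //.
  have -> : (x l + c) / x l = 1 + c / x l by rewrite mulrDl divff // gt_eqF.
  rewrite -[X in _ < X]mulr_natl.
  have -> : l.+1%:R = n%:R * (x l + t) by rewrite xE subrK mulrCA mulfV ?mulr1.
  rewrite -mulrA -[X in X - _]mulr_natl.
  have : n%:R * (2 * t ^+ 2 + ln (1 + c)) <
      n%:R * ((x l + t) * ln (1 + c / x l)).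
    by rewrite ltr_pM2l // ltr0n.
  by apply: le_lt_trans; move: at2; rewrite lnV ?posrE // mulrDr; lra.
exists c, A; split => [||| l ln].
- exact: ltW.
- by apply: lt_trans AgtE; rewrite divr_gt0.
- by move: AgtE; rewrite ltr_pdivrMr // mulrC.
have [xl0|xl] := leP (cut n t l) 0.
  have /eqP -> : cut n t l == 0 by rewrite eq_le xl0 cut_ge0.
  by rewrite expr0n mulr0 exprn_ge0 // add0r ltW.
rewrite -ler_pdivlMr ?exprn_gt0 // -expr_div_n.
by rewrite -[l]/(nat_of_ord (Ordinal ln)); apply: bigmin_le_cond.
Qed.

(** * Tail bound for m(z, U) *)

Lemma measurable_lt d (T : measurableType d) (R : realType)
    (P : probability T R) (Y : {RV P >-> R}) (y : R) :
  measurable [set w | Y w < y].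
Proof.
rewrite (_ : [set _ | _] = Y @^-1` `]-oo, y[).
  by rewrite -[X in measurable X]setTI; exact: measurable_funP.
by apply/seteqP; split => w /=; rewrite in_itv.
Qed.

Lemma prob_lt_le_cdf d (T : measurableType d) (R : realType)
    (P : probability T R) (Y : {RV P >-> R}) (y : R) :
  (P [set w | (Y w < y)%R] <= cdf Y y)%E.
Proof.
apply: le_measure; rewrite ?inE.
- exact: measurable_lt.
- by rewrite -[X in measurable X]setTI; exact: measurable_funP.
- by move=> w /= /ltW; rewrite in_itv.
Qed.

Section tail.
Context d (Omega : measurableType d) (R : realType) (P : probability Omega R).
Context (n : nat) (X : 'I_n -> {RV P >-> R}).
Hypothesis X_indep : mutually_independent X.
Hypothesis X_unif : forall i, uniform01 (X i).

Lemma cells_prob (t : R) (v : {ffun 'I_n -> 'I_n.+1}) : 0 < t ->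
  P [set w | forall i, cell n t (X i w) = v i] =
  (\prod_(i < n) mass (cut n t) (v i))%:E.
Proof.
move=> t0.
have -> : [set w | forall i, cell n t (X i w) = v i] =
    \bigcap_(i in [set` [set: 'I_n]%SET])
      (X i @^-1` [set r | cell n t r = v i]).
  apply/seteqP; split => [w Xv i _|w Xv i]; first exact: Xv.
  by apply: Xv; rewrite /= inE.
rewrite (@X_indep [set: 'I_n]%SET (fun i => [set r | cell n t r = v i]));
  last by move=> i; exact: measurable_cell.
rewrite -prodEFin; apply: eq_big => [i|i _]; first by rewrite inE.
rewrite -uniform_cell // -(X_unif i) //; exact: measurable_cell.
Qed.

(** Outside the event, [mfunc_lt] yields an order statistic at or below its threshold, so the cells
    of the sample form an overfull configuration. The union bound over these and [sum_overfull_le],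
    with total mass 1, conclude. *)
Lemma mfunc_tail (z : n.-tuple R) (t c A : R) :
  (0 < n)%N -> sorted <=%R z -> (forall i, 0 <= tnth z i <= 1) ->
  0 < t -> 0 <= c -> 0 < A ->
  (forall l, (l < n)%N -> A * cut n t l ^+ l.+1 <= (cut n t l + c) ^+ l.+1) ->
  (1 - ((1 + c) ^+ n / A)%:E <=
   P [set w | (mfunc_order_statistics X z w <
               n%:R^-1 * \sum_(i < n) tnth z i + t)%R])%E.
Proof.
move=> n0 zs z01 t0 c0 A0 HA.
pose Y : {RV P >-> R} := mfunc_order_statistics X z.
set y0 := (_ + t); set G := [set w | _].
pose E (v : {ffun 'I_n -> 'I_n.+1}) :=
  [set w | forall i, cell n t (X i w) = v i].
have mE v : measurable (E v).
  rewrite (_ : E v = \bigcap_(i in [set: 'I_n])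
      (X i @^-1` [set r | cell n t r = v i])).
    apply: fin_bigcap_measurable => // i _; rewrite -[X in measurable X]setTI.
    by apply: measurable_funP => //; exact: measurable_cell.
  by apply/seteqP; split => [w Xv i _|w Xv i]; [exact: Xv|exact: (Xv i I)].
have mG : measurable G by exact: (measurable_lt Y).
have sub : ~` G `<=` \bigcup_(v in [set v | overfull n v]) E v.
  move=> w /= Yw; apply: contrapT => Ew; apply: Yw.
  apply: mfunc_lt => // i.
  (* At most i points at or below the cut place the order statistic of rank i + 1 strictly above
     it. *)
  have cb : (count (<= cut n t i)%R [tuple X j w | j < n] <= i)%N.
    rewrite leqNgt; apply/negP => ci; apply: Ew.
    pose v : {ffun 'I_n -> 'I_n.+1} := [ffun j => inord (cell n t (X j w))].
    have vE j : v j = cell n t (X j w) :> nat.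
      by rewrite ffunE inordK // ltnS cell_le.
    exists v => //=; apply/existsP; exists (widen_ord (leqnSn n) i).
    rewrite /= ltnW ?ltn_ord //=; apply: leq_trans ci _.
    rewrite -sum1_count /below -sum1_card big_map.
    rewrite [leqLHS]big_mkcond [leqRHS]big_mkcond -[leqRHS]big_enum.
    apply/eq_leq/eq_bigr => j _.
    by rewrite !inE /= vE cell_leE ?ltn_ord.
  have xi : i.+1%:R / n%:R - t <= cut n t i.
    by rewrite /cut ltn_ord le_max lexx orbT.
  apply: le_lt_trans xi _; rewrite (tnth_nth 0) /=.
  apply: nth_count_gt; first exact: sort_le_sorted.
  by rewrite count_sort cb size_sort size_tuple card_ord ltn_ord.
have fG : P G \is a fin_num by exact: fin_num_measure.
have : (P (~` G) <= ((1 + c) ^+ n / A)%:E)%E.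
  apply: (@le_trans _ _ (\sum_(v | overfull n v) P (E v))%E).
    apply: le_trans (finite_Boole _ _ mE).
    apply: le_measure => //; rewrite inE //.
      exact: measurableC.
    exact: fin_bigcup_measurable.
  under eq_bigr do rewrite cells_prob //.
  rewrite sumEFin lee_fin ler_pdivlMr // mulrC.
  have := @sum_overfull_le _ n n (cut n t) c A
    (@cut_ge0 R n t) (@cut_leS R n t t0) c0 (ltW A0) HA.
  by rewrite {2}/cut ltnn.
rewrite probability_setC // -(fineK fG) -EFinB !lee_fin; lra.
Qed.

End tail.

(** * Comparison with the Hoeffding bound, by cases on [alpha] *)

Theorem corollary1 (R : realType) (d : measure_display)
    (Omega : measurableType d) (P : probability Omega R)
    (n : nat) (X : 'I_n -> {RV P >-> R}) (z : n.-tuple R) (alpha : R) :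
  (1 <= n)%N ->
  mutually_independent X ->
  (forall i : 'I_n, uniform01 (X i)) ->
  sorted <=%R z ->
  (forall i : 'I_n, 0 <= tnth z i <= 1) ->
  0 <= alpha <= 1 ->
  (m_alpha X alpha z <= m_hoeffding alpha z)%E /\
  (alpha <= 1 / 2 -> (m_alpha X alpha z < m_hoeffding alpha z)%E).
Proof.
move=> n0 X_indep X_unif zs z01 /andP[a0 a1].
set Y : {RV P >-> R} := mfunc_order_statistics X z.
have quantile_le y :
    ((1 - alpha)%:E <= cdf Y y)%E -> (m_alpha X alpha z <= y%:E)%E.
  by move=> ay; apply: ereal_inf_lbound; exists y.
set zbar := n%:R^-1 * \sum_(i < n) tnth z i.
have n0' : 0 < n%:R :> R by rewrite ltr0n.
(* At [alpha] = 1 the quantile level is 0, which every real number reaches; the strict claim is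
   vacuous. *)
have [aE|an1] := eqVneq alpha 1.
  split; first last.
    by move=> ah; exfalso; lra.
  have -> : m_hoeffding alpha z = zbar%:E.
    by rewrite /m_hoeffding aE oner_eq0 invr1 ln1 mul0r sqrtr0 addr0.
  by apply: quantile_le; rewrite aE subrr cdf_ge0.
(* Strictness is obtained for every [alpha] below 1. *)
suff lt_hoeffding : (m_alpha X alpha z < m_hoeffding alpha z)%E.
  by split=> [|_ //]; exact: ltW.
(* At [alpha] = 0 a finite bound on the quantile suffices. For t = 1 all cuts of index below n are
   0, so the tail bound holds with c = 1 and every A > 0, which forces probability 1. *)
have [az|an0] := eqVneq alpha 0.
  rewrite /m_hoeffding az eqxx -az.
  apply: (@le_lt_trans _ _ (zbar + 1)%:E); last exact: ltry.
  apply: quantile_le; rewrite az subr0.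
  apply: le_trans (prob_lt_le_cdf Y _).
  have tail A : 0 < A -> (1 - ((1 + 1) ^+ n / A)%:E <=
      P [set w | (mfunc_order_statistics X z w < zbar + 1)%R])%E.
    move=> A0; apply: mfunc_tail => // l ln.
    have -> : cut n 1 l = 0 :> R.
      by rewrite /cut ln; apply/max_idPl; rewrite subr_le0; exact: rank_le1.
    by rewrite expr0n /= mulr0 add0r exprn_ge0.
  set p := P _ in tail *.
  have fp : p \is a fin_num by apply: fin_num_measure; exact: (measurable_lt Y).
  rewrite leNgt -(fineK fp) lte_fin; apply/negP => p1.
  pose K : R := (1 + 1) ^+ n.
  have K0 : 0 < K by rewrite exprn_gt0 // addr_gt0.
  have q0 : 0 < 1 - fine p by rewrite subr_gt0.
  (* If p < 1, this A turns the bound into 1 - (1 - p)/2 <= p, a contradiction. *)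
  have := tail (2 * K / (1 - fine p)).
  rewrite -/K -(fineK fp) divr_gt0 ?mulr_gt0 //.
  have -> : K / (2 * K / (1 - fine p)) = (1 - fine p) / 2.
    by field; rewrite !lt0r_neq0.
  by move=> /(_ isT); rewrite lee_fin; lra.
have a_gt0 : 0 < alpha by rewrite lt_neqAle eq_sym an0.
have a_lt1 : alpha < 1 by rewrite lt_neqAle an1.
have lna : 0 < ln alpha^-1 by rewrite ln_gt0 // invf_gt1.
rewrite /m_hoeffding (negbTE an0); set t := Num.sqrt _.
have t0 : 0 < t by rewrite sqrtr_gt0 divr_gt0 // mulr_gt0.
have at2 : ln alpha^-1 = n%:R * (2 * t ^+ 2).
  rewrite sqr_sqrtr; first by field; exact: lt0r_neq0.
  by rewrite divr_ge0 ?mulr_ge0 // ltW.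
have [|c [A [c0 A0 cA HA]]] := @exists_threshold R n t alpha t0 a_gt0.
  by rewrite at2.
(* The strict inequality (1 + c)^n < [alpha] A puts the probability above 1 - [alpha], which leaves
   room for some y strictly below the Hoeffding bound. *)
have [|y yt ya] := @cdf_left _ _ _ P Y (1 - alpha) (zbar + t).
  apply: lt_le_trans (mfunc_tail X_indep X_unif n0 zs z01 t0 c0 A0 HA).
  by rewrite lte_fin ltrD2l ltrN2 ltr_pdivrMr.
by apply: le_lt_trans (quantile_le y ya) _; rewrite lte_fin.
Qed.
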